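(* Let $G$ be an affine game with two distinct Left options $G^{L_1},G^{L_2}\in G^{\mathcal L}$ such that $G^{L_2}\geqslant G^{L_1}$. Then $G=\{G^{\mathcal L}\setminus\{G^{L_1}\}\mid G^{\mathcal R}\}$.
   Context: Affine games are defined recursively. There are two games without options, denoted $\infty$ and $\overline{\infty}$ (terminating games). Every other affine game is a form $G=\{G^{\mathcal L}\mid G^{\mathcal R}\}$, where $G^{\mathcal L}$ (Left options) and $G^{\mathcal R}$ (Right options) are non-empty finite sets of previously constructed affine games. Let $\mathbb A$ be the set of all affine games. Disjunctive sum: $G+H$ is undefined if one of $G,H$ is the form $\infty$ and the other is $\overline\infty$; it is $\infty$ if one is $\infty$ and the other is not $\overline\infty$; it is $\overline\infty$ if one is $\overline\infty$ and the other is not $\infty$; otherwise $G+H=\{G^{\mathcal L}+H,\,G+H^{\mathcal L}\mid G^{\mathcal R}+H,\,G+H^{\mathcal R}\}$. Outcomes: $o^L(G)=\mathbf L$ if $G=\infty$ or some $G^L\in G^{\mathcal L}$ has $o^R(G^L)=\mathbf L$, and $o^L(G)=\mathbf R$ otherwise; $o^R(G)=\mathbf R$ if $G=\overline\infty$ or some $G^R\in G^{\mathcal R}$ has $o^L(G^R)=\mathbf R$, and $o^R(G)=\mathbf L$ otherwise. With $\mathbf L>\mathbf R$, $o(G)=(o^L(G),o^R(G))$ is ordered componentwise. Order and equality: $G\geqslant H$ iff $o(G+X)\geqslant o(H+X)$ for all $X\in\mathbb A\setminus\{\infty,\overline\infty\}$; $G=H$ (equality of games) iff $o(G+X)=o(H+X)$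 for all such $X$. *)

(* Defs.v *)
From HB Require Import structures.
From mathcomp Require Import all_boot all_order.
From mathcomp Require Import finmap.
Set Implicit Arguments.
Unset Strict Implicit.
Unset Printing Implicit Defensive.
Import Order.TTheory.
Local Open Scope fset_scope.

(* Affine games are hereditarily finite: the options of a form are finite      *)
(* sets, so that forms are equal as soon as they have the same Left and the    *)
(* same Right options.  [pregame] has sequences of options; [game] below is    *)
(* the subtype of those pregames in which every sequence of options is         *)
(* non-empty and is the canonical enumeration of a finite set.                 *)
Inductive pregame : Type :=
  | PInfty
  | PNinfty
  | PForm of seq pregame & seq pregame.

Fixpoint pregame_encode (g : pregame) : GenTree.tree unit :=
  match g with
  | PInfty => GenTree.Node 0 [::]
  | PNinfty => GenTree.Node 1 [::]
  | PForm l r => GenTree.Node 2 [:: GenTree.Node 0 (map pregame_encode l);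
                                    GenTree.Node 0 (map pregame_encode r)]
  end.

Fixpoint pregame_decode (t : GenTree.tree unit) : pregame :=
  match t with
  | GenTree.Node 1 _ => PNinfty
  | GenTree.Node 2 [:: GenTree.Node _ l; GenTree.Node _ r] =>
      PForm (map pregame_decode l) (map pregame_decode r)
  | _ => PInfty
  end.

Fixpoint all_prop (T : Type) (P : T -> Prop) (s : seq T) : Prop :=
  if s is x :: s' then P x /\ all_prop P s' else True.

Lemma pregame_ind_seq (P : pregame -> Prop) :
    P PInfty -> P PNinfty ->
    (forall l r, all_prop P l -> all_prop P r -> P (PForm l r)) ->
  forall g, P g.
Proof.
move=> PI PN PF; fix IH 1; case=> [||l r]; [exact: PI | exact: PN | apply: PF].
  by elim: l => [//|x l IHl]; split; [exact: IH | exact: IHl].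
by elim: r => [//|x r IHr]; split; [exact: IH | exact: IHr].
Qed.

Lemma pregame_encodeK : cancel pregame_encode pregame_decode.
Proof.
elim/pregame_ind_seq => //= l r Hl Hr; congr PForm.
  by elim: l Hl => //= x l IHl [-> /IHl ->].
by elim: r Hr => //= x r IHr [-> /IHr ->].
Qed.

HB.instance Definition _ := Choice.copy pregame (can_type pregame_encodeK).

Lemma pregame_ind_mem (P : pregame -> Prop) :
    P PInfty -> P PNinfty ->
    (forall l r, {in l, forall x, P x} -> {in r, forall x, P x} ->
       P (PForm l r)) ->
  forall g, P g.
Proof.
have mem_all s : all_prop P s -> {in s, forall x, P x}.
  by elim: s => //= y s IHs [Py /IHs Ps] x /[!inE] /predU1P[->|/Ps].
by move=> PI PN PF; elim/pregame_ind_seq => // l r /mem_all Hl /mem_all; exact: PF.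
Qed.

Definition optset (s : seq pregame) : bool := (s != [::]) && canonical_keys s.

Fixpoint wf_pregame (g : pregame) : bool :=
  if g is PForm l r then
    [&& optset l, optset r, all wf_pregame l & all wf_pregame r]
  else true.

Record game : Type := Game { pregame_of : pregame; _ : wf_pregame pregame_of }.

HB.instance Definition _ := [isSub for pregame_of].
HB.instance Definition _ := [Choice of game by <:].

Definition infty : game := @Game PInfty isT.
Definition ninfty : game := @Game PNinfty isT.

Definition terminal (G : game) : bool := (G == infty) || (G == ninfty).

Definition fset_of_seq (s : seq pregame) : {fset game} :=
  [fset x in pmap insub s].

Definition Lopts (G : game) : {fset game} :=
  if val G is PForm l _ then fset_of_seq l else fset0.

Definition Ropts (G : game) : {fset game} :=
  if val G is PForm _ r then fset_of_seq r else fset0.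

(* The form { L | R }; it is a game ([Some]) iff L and R are both non-empty.   *)
Definition form (L R : {fset game}) : option game :=
  insub (PForm (sort_keys (map val L)) (sort_keys (map val R))).

Lemma mem_fset_of_seq (s : seq pregame) (G : game) :
  (G \in fset_of_seq s) = (val G \in s).
Proof.
rewrite inE /= mem_pmap; apply/mapP/idP => [[x xs Gx]|Gs].
  by case: insubP Gx => // u _ ux [->]; rewrite ux.
by exists (val G) => //; rewrite valK.
Qed.

Lemma mem_sort_val (L : {fset game}) (G : game) :
  (val G \in sort_keys (map val L)) = (G \in L).
Proof. by rewrite sort_keysE mem_map //; exact: val_inj. Qed.

Lemma wf_form (L R : {fset game}) :
  wf_pregame (PForm (sort_keys (map val L)) (sort_keys (map val R)))
    = (L != fset0) && (R != fset0).
Proof.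
have wfs (A : {fset game}) : all wf_pregame (sort_keys (map val A)).
  by apply/allP => x; rewrite sort_keysE => /mapP[y _ ->]; exact: valP.
have ne (A : {fset game}) : optset (sort_keys (map val A)) = (A != fset0).
  rewrite /optset canonical_sort_keys andbT; congr (~~ _).
  apply/eqP/eqP => [A0|->]; last exact: sort_keys_nil.
  by apply/fsetP => x; rewrite -mem_sort_val A0.
by rewrite /= !wfs !ne !andbT.
Qed.

Lemma formP (L R : {fset game}) : isSome (form L R) = (L != fset0) && (R != fset0).
Proof. by rewrite /form -wf_form; case: insubP => [? ->|/negbTE ->]. Qed.

Lemma Lopts_form L R G : form L R = Some G -> Lopts G = L.
Proof.
rewrite /form; case: insubP => // u _ uE [<-].
by apply/fsetP => x; rewrite /Lopts uE mem_fset_of_seq mem_sort_val.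
Qed.

Lemma Ropts_form L R G : form L R = Some G -> Ropts G = R.
Proof.
rewrite /form; case: insubP => // u _ uE [<-].
by apply/fsetP => x; rewrite /Ropts uE mem_fset_of_seq mem_sort_val.
Qed.

Lemma form_opts G : ~~ terminal G -> form (Lopts G) (Ropts G) = Some G.
Proof.
case: G => -[||l r] // wfG _.
have keys s : optset s -> all wf_pregame s ->
    sort_keys (map val (fset_of_seq s)) = s.
  case/andP => _ cs /allP wfs; rewrite -[RHS](eqP cs).
  apply/eq_sort_keys => x; apply/mapP/idP => [[y yS ->]|xs].
    by rewrite -mem_fset_of_seq.
  by exists (Game (wfs _ xs)); rewrite // mem_fset_of_seq.
have /and4P[ol or wl wr] := wfG.
rewrite /form /Lopts /Ropts /= !keys //.
by case: insubP => [u _ uE|]; [congr Some; exact: val_inj | rewrite wfG].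
Qed.

Lemma form_nonterminal L R G : form L R = Some G -> ~~ terminal G.
Proof.
by rewrite /form; case: insubP => // u _ uE [<-]; rewrite /terminal -!val_eqE /= !uE.
Qed.

Lemma opts_terminal G : terminal G -> (Lopts G = fset0) /\ (Ropts G = fset0).
Proof. by case/orP => /eqP ->. Qed.

Lemma game_ind_opts (P : game -> Prop) :
    P infty -> P ninfty ->
    (forall G, ~~ terminal G -> {in Lopts G, forall x, P x} ->
       {in Ropts G, forall x, P x} -> P G) ->
  forall G, P G.
Proof.
move=> PI PN PF [g]; elim/pregame_ind_mem: g => [wg|wg|l r IHl IHr wg].
- by rewrite (_ : Game wg = infty) //; exact: val_inj.
- by rewrite (_ : Game wg = ninfty) //; exact: val_inj.
by apply: PF => // -[x wx]; rewrite mem_fset_of_seq /= => xs; [exact: IHl | exact: IHr].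
Qed.

(* The pair (o^L, o^R), where [true] stands for L and [false] for R; in        *)
(* particular L > R is the order of [bool].                                    *)
Fixpoint pregame_outcome (g : pregame) : bool * bool :=
  match g with
  | PInfty => (true, true)
  | PNinfty => (false, false)
  | PForm l r => (has (fun x => (pregame_outcome x).2) l,
                  ~~ has (fun x => ~~ (pregame_outcome x).1) r)
  end.

Definition oL (G : game) : bool := (pregame_outcome (val G)).1.
Definition oR (G : game) : bool := (pregame_outcome (val G)).2.

(* [*p] carries the componentwise order.                                       *)
Definition outcome (G : game) : bool *p bool := (oL G, oR G).

Lemma has_fset_of_seq (p : pred pregame) (s : seq pregame) :
  all wf_pregame s -> has (p \o val) (fset_of_seq s) = has p s.
Proof.
move=> /allP wfs; apply/hasP/hasP => [[x xs px]|[x xs px]].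
  by exists (val x) => //; rewrite -mem_fset_of_seq.
by exists (Game (wfs _ xs)); rewrite // mem_fset_of_seq.
Qed.

Lemma oLE (G : game) : oL G = (G == infty) || has oR (Lopts G).
Proof.
case: G => -[||l r] // wg; have /and4P[_ _ wl _] := wg.
by rewrite -val_eqE /oL /Lopts /= -(has_fset_of_seq _ wl).
Qed.

Lemma oRE (G : game) :
  oR G = ~~ ((G == ninfty) || has (fun x => ~~ oL x) (Ropts G)).
Proof.
case: G => -[||l r] // wg; have /and4P[_ _ _ wr] := wg.
by rewrite -val_eqE /oR /Ropts /= -(has_fset_of_seq _ wr).
Qed.

(* One unfolding of the disjunctive sum, where [None] means undefined and [f]  *)
(* is the recursive call.  In the last case both games are non-terminal, so    *)
(* that all the sums in the sets of options are defined ([add_defined] below)  *)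
(* and [pmap] discards nothing.                                                *)
Definition add_step (f : game -> game -> option game) (G H : game) : option game :=
  if ((G == infty) && (H == ninfty)) || ((G == ninfty) && (H == infty)) then None
  else if (G == infty) || (H == infty) then Some infty
  else if (G == ninfty) || (H == ninfty) then Some ninfty
  else form ([fset x in pmap (f^~ H) (Lopts G)] `|` [fset x in pmap (f G) (Lopts H)])
            ([fset x in pmap (f^~ H) (Ropts G)] `|` [fset x in pmap (f G) (Ropts H)]).

Fixpoint pregame_size (g : pregame) : nat :=
  if g is PForm l r then
    (sumn (map pregame_size l) + sumn (map pregame_size r)).+1
  else 0.

Definition game_size (G : game) : nat := pregame_size (val G).

Fixpoint add_fuel (n : nat) : game -> game -> option game :=
  if n is n'.+1 then add_step (add_fuel n') else fun _ _ => None.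

(* The amount of fuel suffices: [addE] is the recursive equation of the sum.   *)
Definition add (G H : game) : option game :=
  add_fuel (game_size G + game_size H).+1 G H.

Lemma game_size_lt (G x : game) :
  (x \in Lopts G) || (x \in Ropts G) -> game_size x < game_size G.
Proof.
have mem_le (y : pregame) s : y \in s -> pregame_size y <= sumn (map pregame_size s).
  elim: s => //= z s IHs /[!inE] /predU1P[->|/IHs]; first exact: leq_addr.
  by move=> /leq_trans; apply; exact: leq_addl.
case: G => -[||l r] // wg; rewrite !mem_fset_of_seq /game_size /= ltnS.
by case/orP => /mem_le /leq_trans; apply; rewrite (leq_addr, leq_addl).
Qed.

Lemma eq_add_step f g G H :
    {in Lopts G, forall x, f x H = g x H} -> {in Ropts G, forall x, f x H = g x H} ->
    {in Lopts H, forall x, f G x = g G x} -> {in Ropts H, forall x, f G x = g G x} ->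
  add_step f G H = add_step g G H.
Proof.
have pmapE (h k : game -> option game) (s : seq game) :
    {in s, forall x, h x = k x} -> pmap h s = pmap k s.
  elim: s => //= x s IHs hk; rewrite hk ?mem_head // IHs // => y ys.
  by apply: hk; rewrite inE ys orbT.
move=> fgL fgR fgL' fgR'; rewrite /add_step.
by rewrite (pmapE _ _ _ fgL) (pmapE _ _ _ fgR) (pmapE _ _ _ fgL') (pmapE _ _ _ fgR').
Qed.

Lemma add_fuelE n m G H :
    game_size G + game_size H < n -> game_size G + game_size H < m ->
  add_fuel n G H = add_fuel m G H.
Proof.
elim: n m G H => // n IHn [//|m] G H /[!ltnS] Hn Hm /=.
apply: eq_add_step => x xin; apply: IHn.
all: try (by apply: leq_trans Hn; rewrite (ltn_add2r, ltn_add2l) game_size_lt ?xin ?orbT).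
all: by apply: leq_trans Hm; rewrite (ltn_add2r, ltn_add2l) game_size_lt ?xin ?orbT.
Qed.

Lemma addE (G H : game) : add G H = add_step add G H.
Proof.
rewrite {1}/add /=; apply: eq_add_step => x xin; apply: add_fuelE => //.
all: by rewrite (ltn_add2r, ltn_add2l) game_size_lt ?xin ?orbT.
Qed.

Lemma add_defined (G H : game) : ~~ terminal G || ~~ terminal H -> isSome (add G H).
Proof.
have pmap_ne0 (f : game -> option game) (A B : {fset game}) : A != fset0 ->
    {in A, forall x, isSome (f x)} -> [fset x in pmap f A] `|` B != fset0.
  move=> /fset0Pn[x xA] /(_ x xA); case fx: (f x) => [y|] // _.
  apply/fset0Pn; exists y; rewrite !inE mem_pmap.
  by apply/orP; left; apply/mapP; exists x; rewrite ?fx.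
elim/game_ind_opts: G => [|| G ntG IHL IHR].
- rewrite addE /add_step /terminal /=.
  by case: (H == infty); case: (H == ninfty).
- rewrite addE /add_step /terminal /=.
  by case: (H == infty); case: (H == ninfty).
move=> _; rewrite addE /add_step.
have := ntG; rewrite /terminal negb_or => /andP[/negbTE -> /negbTE ->] /=.
case: eqP => //= HI; case: eqP => //= HN.
have ntH : ~~ terminal H by rewrite negb_or; apply/andP; split; apply/eqP.
have := formP (Lopts G) (Ropts G); rewrite form_opts // => /esym/andP[L0 R0].
rewrite formP !pmap_ne0 // => x xG; [apply: IHR | apply: IHL] => //.
all: by rewrite ntH orbT.
Qed.

Definition game_ge (G H : game) : Prop :=
  forall X : game, ~~ terminal X ->
    exists GX HX : game,
      [/\ add G X = Some GX, add H X = Some HX & (outcome HX <= outcome GX)%O].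

(* Equality of games, as opposed to the identity of forms [G = H].             *)
Definition game_eq (G H : game) : Prop :=
  forall X : game, ~~ terminal X ->
    exists GX HX : game,
      [/\ add G X = Some GX, add H X = Some HX & outcome GX = outcome HX].

(* Main.v *)
Require Import Defs.
From mathcomp Require Import all_boot all_order.
From mathcomp Require Import finmap.
Local Open Scope fset_scope.

(* Write G' for G without its Left option G1.  By induction on X, the options of
   G + X and G' + X match in outcome, except that Left loses the move to G1 + X;
   her move to G2 + X is at least as good, because G2 >= G1. *)

Lemma add_form (G H : game) : ~~ terminal G -> ~~ terminal H ->
  add G H =
    form ([fset x in pmap (add^~ H) (Lopts G)] `|` [fset x in pmap (add G) (Lopts H)])
         ([fset x in pmap (add^~ H) (Ropts G)] `|` [fset x in pmap (add G) (Ropts H)]).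
Proof.
rewrite /terminal !negb_or => /andP[/negbTE GI /negbTE GN] /andP[/negbTE HI /negbTE HN].
by rewrite addE /add_step GI GN HI HN.
Qed.

(** A terminal [X] absorbs any non-terminal summand, so both sums are [X] itself. This settles the
    base cases of the induction on [X]. *)
Lemma add_terminal (G H X : game) : ~~ terminal G -> ~~ terminal H -> terminal X ->
  add G X = add H X.
Proof.
rewrite /terminal !negb_or => /andP[/negbTE GI /negbTE GN] /andP[/negbTE HI /negbTE HN].
by rewrite !addE /add_step GI GN HI HN /=; case/orP => /eqP ->.
Qed.

(** Since [pmap] drops undefined values, they count as failing [p]. *)
Lemma has_fsetU_pmap (p : pred game) (f g : game -> option game) (s t : seq game) :
  has p ([fset x in pmap f s] `|` [fset x in pmap g t]) =
  has (fun x => oapp p false (f x)) s || has (fun x => oapp p false (g x)) t.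
Proof.
have has_pmap (h : game -> option game) u :
    has p (pmap h u) = has (fun x => oapp p false (h x)) u.
  by elim: u => //= x u <-; case: (h x).
rewrite -!has_pmap -has_cat; apply: eq_has_r => x.
by rewrite !inE mem_cat.
Qed.

(** The sum [K] is a form, hence not [infty], so only its Left options decide [oL K]. *)
Lemma oL_add (G H K : game) : ~~ terminal G -> ~~ terminal H -> add G H = Some K ->
  oL K = has (fun x => oapp oR false (add x H)) (Lopts G)
      || has (fun x => oapp oR false (add G x)) (Lopts H).
Proof.
move=> ntG ntH; rewrite add_form // => KE.
have := form_nonterminal KE => /norP[/negbTE KI _].
by rewrite oLE KI (Lopts_form KE) has_fsetU_pmap.
Qed.

Lemma oR_add (G H K : game) : ~~ terminal G -> ~~ terminal H -> add G H = Some K ->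
  oR K = ~~ (has (fun x => oapp (fun y => ~~ oL y) false (add x H)) (Ropts G)
          || has (fun x => oapp (fun y => ~~ oL y) false (add G x)) (Ropts H)).
Proof.
move=> ntG ntH; rewrite add_form // => KE.
have := form_nonterminal KE => /norP[_ /negbTE KN].
by rewrite oRE KN (Ropts_form KE) has_fsetU_pmap.
Qed.

(** Used after a Left move, when Right is next to play: only the second component of the outcome
    order matters. *)
Lemma game_ge_oR (G H X : game) : game_ge G H -> ~~ terminal X ->
  oapp oR false (add H X) -> oapp oR false (add G X).
Proof.
move=> GH /GH[GX [HX [-> ->]]]; rewrite Order.ProdOrder.leEprod => /andP[_ /=].
by case: (oR HX); case: (oR GX).
Qed.

(** Carries the induction hypothesis on the options of [X] over to the terms of [oL_add] and
    [oR_add]. *)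
Lemma omap_outcome_has (f g : game -> option game) (s : seq game) :
    {in s, forall x, omap outcome (f x) = omap outcome (g x)} ->
  has (fun x => oapp oR false (f x)) s = has (fun x => oapp oR false (g x)) s /\
  has (fun x => oapp (fun y => ~~ oL y) false (f x)) s =
    has (fun x => oapp (fun y => ~~ oL y) false (g x)) s.
Proof.
move=> fg; split; apply: eq_in_has => x /fg.
all: by case: (f x) (g x) => [y|] [z|] //= [yzL yzR]; rewrite ?yzL ?yzR.
Qed.

Theorem theorem38 (G G1 G2 : game) (hG1 : G1 \in Lopts G) (hG2 : G2 \in Lopts G)
    (hne : G1 <> G2) (hge : game_ge G2 G1) :
  exists2 G' : game,
    form (Lopts G `\ G1) (Ropts G) = Some G' & game_eq G G'.
Proof.
have ntG : ~~ terminal G.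
  by apply/negP => /opts_terminal[L0 _]; rewrite L0 in_fset0 in hG1.
have G2L' : G2 \in Lopts G `\ G1 by rewrite !inE hG2 andbT; apply/eqP => /esym.
(* [G2] survives the removal of [G1], so the Left options stay non-empty. *)
have : isSome (form (Lopts G `\ G1) (Ropts G)).
  have := formP (Lopts G) (Ropts G); rewrite form_opts // => /esym/andP[_ R0].
  by rewrite formP R0 andbT; apply/fset0Pn; exists G2.
case G'E: form => [G'|] // _; exists G' => //.
have ntG' := form_nonterminal G'E.
(* Terminal [X] are included, unlike in [game_eq], because a non-terminal [X] may have terminal
   options. *)
have sumE X : omap outcome (add G X) = omap outcome (add G' X).
  elim/game_ind_opts: X => [|| X ntX IHL IHR]; try by rewrite (add_terminal _ _ _ ntG ntG').
  have := @add_defined G X; have := @add_defined G' X.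
  rewrite ntX !orbT => /(_ isT) + /(_ isT).
  case G'XE: (add G' X) => [K'|] // _; case GXE: (add G X) => [K|] // _ /=.
  rewrite /outcome (oL_add _ _ _ ntG ntX GXE) (oL_add _ _ _ ntG' ntX G'XE).
  rewrite (oR_add _ _ _ ntG ntX GXE) (oR_add _ _ _ ntG' ntX G'XE).
  rewrite (Ropts_form G'E) (Lopts_form G'E).
  rewrite (omap_outcome_has _ _ _ IHL).1 (omap_outcome_has _ _ _ IHR).2.
  (* Only Left's moves in [G] and in [G'] remain to be compared. *)
  congr (Some (_ || _, _)); apply/hasP/hasP => -[x xL xR]; last first.
    by exists x => //; move: xL; rewrite !inE => /andP[].
  (* A winning move to [G1] is replaced by the move to [G2]. *)
  have [xG1|xG1] := eqVneq x G1; last by exists x; rewrite // !inE xG1.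
  by exists G2 => //; apply: game_ge_oR _ _ _ hge ntX _; rewrite -xG1.
move=> X ntX; have := sumE X; have := @add_defined G X; have := @add_defined G' X.
rewrite ntX !orbT => /(_ isT) + /(_ isT).
by case: (add G' X) (add G X) => [K'|] [K|] // _ _ [KL KR]; exists K, K'; rewrite /outcome KL KR.
Qed.
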